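(* Let $\mathcal{Z}\subset\mathbb{R}$, let $$\mathcal{H}=\left\{z\mapsto \frac{1}{\sqrt{2\pi\sigma^2}}\exp\left(-\frac{1}{2\sigma^2}z^2\right)\;\middle|\;\sigma>0\right\}$$ be the class of one-dimensional normal densities with mean $0$ and unknown variance, and let the loss $\ell(z,h)=-\log h(z)$ be the negative log-likelihood. If there exists an open ball $B_0$ that contains the origin, such that $B_0\subset\mathcal{Z}$, then estimating the variance of a one-dimensional normal density (that is, the learner $A_{\mathrm{erm}}$ that minimizes the empirical risk over $\mathcal{H}$ for $\ell$) is not weakly $(\mathcal{Z},\ell,N)$-monotonic for any $N\in\mathbb{N}$.
   Context: $\mathbb{N}=\{1,2,\ldots\}$. Given a domain $\mathcal{Z}$, a hypothesis class $\mathcal{H}$ and a loss $\ell:\mathcal{Z}\times\mathcal{H}\to\mathbb{R}$, a learner is a map $A:\mathcal{Z}\cup\mathcal{Z}^2\cup\mathcal{Z}^3\cup\cdots\to\mathcal{H}$. For a probability distribution $D$ on $\mathcal{Z}$, the risk of $h\in\mathcal{H}$ is $R_D(h)=\mathbb{E}_{z\sim D}\,\ell(z,h)$. For a training set $S_n=(z_1,\ldots,z_n)\in\mathcal{Z}^n$, the empirical risk is $R_{S_n}(h)=\frac1n\sum_{i=1}^n\ell(z_i,h)$, and the empirical risk minimizer is $A_{\mathrm{erm}}(S_n)=\operatorname{argmin}_{h\in\mathcal{H}}R_{S_n}(h)$. Local monotonicity: a learner $A$ is $(D,\ell,n)$-monotonic, for a distribution $D$, a loss $\ell$ and $n\in\mathbb{N}$,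 if $\mathbb{E}_{S_{n+1}\sim D^{n+1}}[R_D(A(S_{n+1}))-R_D(A(S_n))]\le 0$, where $S_{n+1}=(z_1,\ldots,z_{n+1})$ is sampled i.i.d. from $D$ and $S_n=(z_1,\ldots,z_n)$. Local $\mathcal{Z}$-monotonicity: $A$ is locally $(\mathcal{Z},\ell,n)$-monotonic if, for all distributions $D$ on $\mathcal{Z}$, it is $(D,\ell,n)$-monotonic. Weak $\mathcal{Z}$-monotonicity: for $N\in\mathbb{N}$, $A$ is weakly $(\mathcal{Z},\ell,N)$-monotonic if for all integers $n\ge N$ it is locally $(\mathcal{Z},\ell,n)$-monotonic. *)

(* Defs.v *)
From HB Require Import structures.
From mathcomp Require Import all_boot all_order all_algebra.
From mathcomp Require Import all_classical all_reals all_analysis.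

Set Implicit Arguments.
Unset Strict Implicit.
Unset Printing Implicit Defensive.

Import Order.TTheory GRing.Theory Num.Theory.
Import numFieldNormedType.Exports.

Local Open Scope classical_set_scope.
Local Open Scope ring_scope.

Section sampling.
Context {d : measure_display} {T : measurableType d} {R : realType}.

Definition cons_sample n (x : T * n.-tuple T) : n.+1.-tuple T :=
  [the n.+1.-tuple T of x.1 :: x.2].

Let measurable_cons_sample n : measurable_fun setT (@cons_sample n).
Proof. exact: measurable_cons. Qed.

HB.instance Definition _ n :=
  isMeasurableFun.Build _ _ _ _ (@cons_sample n) (@measurable_cons_sample n).

(* The n-fold product D^n, i.e. the law of n i.i.d. draws from D. *)
Fixpoint iid (D : probability T R) n : probability (n.-tuple T) R :=
  match n with
  | 0 => dirac [tuple]
  | m.+1 => distribution (D \x iid D m)%E (@cons_sample m)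
  end.

End sampling.

(* Only nonempty training sets are meaningful; the value at n = 0 plays no role
   in what follows for n, N >= 1. *)
Definition learner (Z H : Type) := forall n, n.-tuple Z -> H.

Section learning.
Context {d : measure_display} {T : measurableType d} {H : Type} {R : realType}.
Implicit Types (l : T -> H -> R) (D : probability T R) (n N : nat).

Implicit Type A : learner T H.

Definition risk l D (h : H) : \bar R := (\int[D]_z (l z h)%:E)%E.

Definition empirical_risk l n (S : n.-tuple T) (h : H) : R :=
  n%:R^-1 * \sum_(i < n) l (tnth S i) h.

Definition empirical_risk_minimizer l n (S : n.-tuple T) (h : H) :=
  forall h', empirical_risk l S h <= empirical_risk l S h'.

(* The argmin may fail to exist (for the normal model, when the sample is
   identically 0); the output of the learner on such samples is unconstrained. *)
Definition erm l A :=
  forall n (S : n.-tuple T), (0 < n)%N ->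
    (exists h, empirical_risk_minimizer l S h) ->
    empirical_risk_minimizer l S (A n S).

Definition sample_prefix n (S : n.+1.-tuple T) : n.-tuple T :=
  [tuple tnth S (widen_ord (leqnSn n) i) | i < n].

(* Extended-real subtraction and integration use +oo - +oo = -oo, so an
   indeterminate difference never counts against monotonicity. *)
Definition monotonic D l n A : Prop :=
  (\int[iid D n.+1]_S
     (risk l D (A n.+1 S) - risk l D (A n (sample_prefix S))) <= 0)%E.

Definition locally_monotonic l n A := forall D, monotonic D l n A.

Definition weakly_monotonic l N A :=
  forall n, (N <= n)%N -> locally_monotonic l n A.

End learning.

(* A nonempty subset of the real line with the trace of the Borel sigma-algebra.
   The base point is only needed because measurable types are pointed. *)
Section subset_space.
Context {R : realType} {Z : set R} {z0 : R}.

Definition pointed_subset of Z z0 : Type := Z.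

Variable Zz0 : Z z0.

HB.instance Definition _ := Choice.copy (pointed_subset Zz0) Z.
HB.instance Definition _ :=
  isPointed.Build (pointed_subset Zz0) (exist _ z0 (mem_set Zz0)).

Definition subset_incl (z : pointed_subset Zz0) : measurableTypeR R := set_val z.

Definition subset_space := g_sigma_algebra_preimageType subset_incl.

End subset_space.

Arguments subset_incl {R Z z0} Zz0 z.

Lemma ball_sub_origin {R : realType} {Z : set R} :
  (exists c r : R, ball c r 0 /\ ball c r `<=` Z) -> Z 0.
Proof. by move=> [c [r [B0 BZ]]]; exact: BZ. Qed.

Section normal_model.
Context {R : realType}.

(* The second argument of normal_pdf is the standard deviation. *)
Definition centered_normal_densities : set (R -> R) :=
  [set h | exists2 sigma : R, 0 < sigma & h = normal_pdf 0 sigma].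

Definition neg_log_likelihood {Z : set R} {z0 : R} (Zz0 : Z z0)
    (z : subset_space Zz0) (h : centered_normal_densities) : R :=
  - ln (set_val h (subset_incl Zz0 z)).

End normal_model.

Arguments neg_log_likelihood {R Z z0} Zz0 z h.
Arguments centered_normal_densities R : clear implicits.

(* Main.v *)
(* Take the two-point distribution with mass 1 - q at a and q at b, where
   b^2 = (1 + u) a^2. A sample in which b has frequency x has maximum-likelihood
   variance a^2 (1 + u x), and the risk of that estimate is, up to a constant,
   half of g(x) = ln (1 + u x) + (1 + q u) / (1 + u x). As q -> 0, to first order
   only the samples of size n + 1 with exactly one b matter, and they contribute
   (n + 1) g(1/(n + 1)) - n g(1/n) - g(0) to the difference of expected risks,
   which behaves like ln u: appending one more a to a sample containing a single
   b helps by a bounded amount, whereas appending b to an all-a sample raises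
   g by about ln u. Hence for u large and then q small, the expected risk
   increases. The point a is nonzero, so the all-zero sample never occurs. *)
From HB Require Import structures.
Require Import Defs.
From mathcomp Require Import all_boot all_order all_algebra.
From mathcomp Require Import finmap ring lra.
From mathcomp Require Import all_classical all_reals all_analysis.
Import Order.TTheory GRing.Theory Num.Theory.
Import numFieldNormedType.Exports.
Local Open Scope classical_set_scope.
Local Open Scope ring_scope.

(** * Integrals against finitely supported measures *)

Section finite_support.
Context {d : measure_display} {T : measurableType d} {R : realType}
  {I : finType}.
Implicit Types (m : set T -> \bar R) (x : I -> T) (w : I -> R).

Definition finitely_supported m x w := forall A, measurable A ->
  m A = (\sum_i w i * \1_A (x i))%:E.

Variables (mu : {measure set T -> \bar R}) (x : I -> T) (w : I -> R).
Hypothesis muE : finitely_supported mu x w.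
Hypothesis w_ge0 : forall i, 0 <= w i.
Hypothesis x_inj : injective x.
Hypothesis measurable_x : forall i, measurable [set x i].

Import HBNNSimple.

Lemma sintegral_finitely_supported (h : {nnsfun T >-> R}) :
  sintegral mu h = (\sum_i w i * h (x i))%:E.
Proof.
rewrite sintegralE fsbig_finite//=.
under eq_bigr => y _ do rewrite muE// -EFinM mulr_sumr.
rewrite sumEFin exchange_big/=; congr EFin; apply: eq_bigr => i _.
have hxi : h (x i) \in fset_set (range h).
  by rewrite in_fset_set// inE; exists (x i).
rewrite (big_fsetD1 (h (x i)))//= indicE mem_set//= mulr1 mulrC.
rewrite big_seq big1 ?addr0// => y /fsetD1P[yxi _].
rewrite indicE memNset ?mulr0// => /= hy.
by rewrite hy eqxx in yxi.
Qed.

(** The integral is a supremum over simple functions below [f]. Each of them integrates to a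
    weighted sum of its values on the support, and the bound is attained by [g], which agrees with
    [f] on the support and vanishes elsewhere. *)
Let ge0_integral_finitely_supported (f : T -> R) : (forall t, 0 <= f t) ->
  (\int[mu]_t (f t)%:E)%E = (\sum_i w i * f (x i))%:E.
Proof.
move=> f0; rewrite ge0_integralTE; last by move=> t; rewrite lee_fin.
apply/eqP; rewrite eq_le; apply/andP; split.
  apply: ge_ereal_sup => /= _ [h hf <-].
  rewrite sintegral_finitely_supported lee_fin.
  by apply: ler_sum => i _; apply: ler_wpM2l => //; rewrite -lee_fin.
pose g := \big[add_nnsfun/nnsfun0]_(i : I)
  scale_nnsfun (indic_nnsfun R (measurable_x i)) (f0 (x i)).
have gE t : g t = \sum_i f (x i) * \1_[set x i] t.
  by rewrite /g; elim/big_ind2 : _ => [|y g1 z g2 <- <-|].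
have gx i : g (x i) = f (x i).
  rewrite gE (bigD1 i)//= indicE mem_set// mulr1 big1 ?addr0// => j ji.
  rewrite indicE memNset ?mulr0// => /= /x_inj ij.
  by rewrite ij eqxx in ji.
apply: ereal_sup_ubound => /=; exists g.
  move=> t; rewrite lee_fin.
  have [[i ->]|xt] := pselect (exists i, t = x i); first by rewrite gx.
  rewrite gE big1// => i _; rewrite indicE memNset ?mulr0// => /= txi.
  by apply: xt; exists i.
rewrite sintegral_finitely_supported.
by congr EFin; apply: eq_bigr => i _; rewrite -[in RHS]gx.
Qed.

(* [f] need not be measurable, so nothing has to be known about the learner
   outside the support. *)
Lemma integral_finitely_supported (f : T -> R) :
  (\int[mu]_t (f t)%:E)%E = (\sum_i w i * f (x i))%:E.
Proof.
rewrite integralE (funerpos f) (funerneg f).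
rewrite !ge0_integral_finitely_supported//.
rewrite -EFinB -sumrB; congr EFin; apply: eq_bigr => i _.
by rewrite -mulrBr -[in RHS](funrposBneg f).
Qed.

End finite_support.

(** * I.i.d. samples from a finitely supported law *)

Lemma big_tuple_cons {R : nmodType} {I : finType} n (F : n.+1.-tuple I -> R) :
  \sum_t F t = \sum_i \sum_(t : n.-tuple I) F [tuple of i :: t].
Proof.
rewrite pair_big/=.
rewrite (reindex (fun p : I * n.-tuple I => [tuple of p.1 :: p.2]))//=.
exists (fun t => (thead t, [tuple of behead t])) => [[i t] _|t _]/=.
  by congr (_, _); apply/val_inj.
by rewrite -tuple_eta.
Qed.

Lemma measurable_tuple1 {d : measure_display} {T : measurableType d} n
    (t : n.-tuple T) : (forall i, measurable [set tnth t i]) ->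
  measurable [set t].
Proof.
move=> mt; rewrite (_ : [set t] =
    \bigcap_(i in [set: 'I_n])
      ((fun s : n.-tuple T => tnth s i) @^-1` [set tnth t i])).
  apply: fin_bigcap_measurable => // i _; rewrite -[X in measurable X]setTI.
  exact: measurable_tnth.
apply/seteqP; split => [s -> i//|s st]; apply: eq_from_tnth => i.
exact: st.
Qed.

Section iid_finite_support.
Context {d : measure_display} {T : measurableType d} {R : realType}
  {I : finType}.
Variables (D : probability T R) (x : I -> T) (w : I -> R).
Hypothesis DE : finitely_supported D x w.
Hypothesis w_ge0 : forall i, 0 <= w i.
Hypothesis x_inj : injective x.
Hypothesis measurable_x : forall i, measurable [set x i].

Lemma iid_finitely_supported n :
  finitely_supported (iid D n) (fun t : n.-tuple I => [tuple of map x t])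
    (fun t => \prod_(i < n) w (tnth t i)).
Proof.
elim: n => [|n IHn] A mA.
  rewrite (big_pred1 [tuple]) => [|t]; last first.
    by apply/esym/eqP; rewrite [t]tuple0.
  rewrite big_ord0 mul1r/= diracE indicE; congr (_%:R%:E)%R; congr (_ \in A).
  exact/val_inj.
have mA' : measurable (@cons_sample d T n @^-1` A).
  by rewrite -[X in measurable X]setTI; exact: measurable_funP.
(* The product measure of a set is the [D]-integral of the [iid D n]-measures of its sections; the
   induction hypothesis turns these into finite sums. *)
have -> : iid D n.+1 A = (\int[D]_z (\sum_(t : n.-tuple I)
    (\prod_(i < n) w (tnth t i)) *
      \1_(xsection (@cons_sample d T n @^-1` A) z) [tuple of map x t])%:E)%E.
  apply: eq_integral => z _ /=.
  by rewrite IHn//; exact: measurable_xsection.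
rewrite (integral_finitely_supported _ _ _ DE)// big_tuple_cons.
congr EFin; apply: eq_bigr => i _; rewrite mulr_sumr; apply: eq_bigr => t _.
rewrite mulrA; congr (_ * _).
  rewrite big_ord_recl/=; congr (_ * _).
  by apply: eq_bigr => j _; rewrite tnthS.
rewrite !indicE mem_xsection; congr (_%:R).
congr nat_of_bool; apply/idP/idP; rewrite !inE/=;
  by congr A; apply/val_inj.
Qed.

End iid_finite_support.

Lemma exists_two_point_distribution {d : measure_display} {T : measurableType d}
    {R : realType} (q : R) (x : bool -> T) : 0 <= q <= 1 ->
  exists D : probability T R, finitely_supported D x (bernoulli_pmf q).
Proof.
move=> q01; have mx : x \in mfun by rewrite inE.
exists (distribution (bernoulli_prob q) (mfun_Sub mx)) => A mA.
rewrite /distribution /pushforward/= bernoulli_probE//.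
by rewrite big_bool/= /bernoulli_pmf !diracE !indicE -!EFinM -EFinD.
Qed.

(** * Gaussian likelihood and its empirical minimizer *)

Lemma ln_lt_sub1 {R : realType} (y : R) : 0 < y -> y != 1 -> ln y < y - 1.
Proof.
move=> y0 y1; rewrite ltrBrDl -[ltRHS]lnK//.
by apply: expR_gt1Dx; rewrite ln_eq0.
Qed.

Section normal_erm.
Context {R : realType} {Z : set R} {z0 : R} (Zz0 : Z z0).
Notation space := (subset_space Zz0).
Notation density := (centered_normal_densities R).
Notation nll := (neg_log_likelihood Zz0).
Implicit Types (h : density) (z : space) (v s : R).

Definition mean_square n (S : n.-tuple space) : R :=
  n%:R^-1 * \sum_(i < n) subset_incl Zz0 (tnth S i) ^+ 2.

(** Here [v] is the variance and [y] the square of the observation. The expression is affine in [y],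
    so averaging over a sample amounts to evaluating at the mean square. *)
Definition gaussian_nll v (y : R) : R := (ln (pi *+ 2) + ln v + y / v) / 2.

Lemma neg_log_likelihoodE h sigma z : 0 < sigma ->
  set_val h = normal_pdf 0 sigma ->
  nll z h = gaussian_nll (sigma ^+ 2) (subset_incl Zz0 z ^+ 2).
Proof.
move=> sigma0 hE; rewrite /neg_log_likelihood hE normal_pdfE ?gt_eqF//.
rewrite /normal_peak /normal_fun subr0 /gaussian_nll.
have p0 : 0 < sigma ^+ 2 * pi *+ 2 :> R.
  by rewrite pmulrn_lgt0// mulr_gt0 ?pi_gt0// exprn_gt0.
rewrite lnM ?posrE ?invr_gt0 ?sqrtr_gt0 ?expR_gt0// expRK.
rewrite lnV ?posrE ?sqrtr_gt0//.
set L := ln (Num.sqrt _).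
have -> : ln (pi *+ 2) + ln (sigma ^+ 2) = 2 * L.
  rewrite mulr_natl -lnXn ?sqrtr_gt0// sqr_sqrtr ?ltW// -mulrnAr mulrC.
  rewrite [RHS]lnM//.
    by rewrite posrE pmulrn_lgt0 ?pi_gt0.
  by rewrite posrE exprn_gt0.
rewrite -[sigma ^+ 2 *+ 2]mulr_natr.
by field; rewrite gt_eqF.
Qed.

Lemma densityP h : exists2 s, 0 < s & forall z,
  nll z h = gaussian_nll s (subset_incl Zz0 z ^+ 2).
Proof.
have [sigma sigma0 hE] := set_valP h.
exists (sigma ^+ 2) => [|z]; first exact: exprn_gt0.
exact: neg_log_likelihoodE.
Qed.

Lemma density_exists s : 0 < s -> exists h, forall z,
  nll z h = gaussian_nll s (subset_incl Zz0 z ^+ 2).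
Proof.
move=> s0; have hs : centered_normal_densities R (normal_pdf 0 (Num.sqrt s)).
  by exists (Num.sqrt s) => //; rewrite sqrtr_gt0.
exists (exist (fun f => f \in centered_normal_densities R) _ (mem_set hs)) => z.
by rewrite (neg_log_likelihoodE _ (Num.sqrt s)) ?sqrtr_gt0// sqr_sqrtr// ltW.
Qed.

(** The gap is half of [r - 1 - ln r] with [r = v / s], positive unless [r = 1]. The equality case
    is what identifies the output of the learner. *)
Lemma gaussian_nll_min v s : 0 < v -> 0 < s ->
  gaussian_nll v v <= gaussian_nll s v ?= iff (s == v).
Proof.
move=> v0 s0; have [->|sv] := eqVneq s v; first exact/leifP.
have vs1 : v / s != 1.
  by apply: contra_neq sv => /(congr1 ( *%R^~ s));
    rewrite divfK ?gt_eqF// mul1r.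
apply/leifP; rewrite /gaussian_nll ltr_pM2r ?invr_gt0// divff ?gt_eqF//.
have := ln_lt_sub1 (v / s) (divr_gt0 v0 s0) vs1.
rewrite ln_div// => ?; lra.
Qed.

Lemma empirical_nll n (S : n.-tuple space) h s : (0 < n)%N ->
  (forall z, nll z h = gaussian_nll s (subset_incl Zz0 z ^+ 2)) ->
  empirical_risk nll S h = gaussian_nll s (mean_square n S).
Proof.
move=> n0 hs; rewrite /empirical_risk; under eq_bigr do rewrite hs.
have nN0 : n%:R != 0 :> R by rewrite pnatr_eq0 -lt0n.
rewrite -mulr_suml big_split/= sumr_const card_ord -mulr_suml.
rewrite -[(_ + _) *+ n]mulr_natl.
rewrite /gaussian_nll /mean_square.
by rewrite mulrA mulrDr mulKf// mulrA.
Qed.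

Variable A : learner space density.
Hypothesis hA : erm nll A.

(** A positive mean square is itself an admissible variance, so a minimizer exists and [erm]
    constrains [A]; uniqueness of the minimizing variance then determines the loss of [A n S]. *)
Lemma erm_nll n (S : n.-tuple space) z : (0 < n)%N -> 0 < mean_square n S ->
  nll z (A n S) = gaussian_nll (mean_square n S) (subset_incl Zz0 z ^+ 2).
Proof.
move=> n0 v0; have [h hv] := density_exists _ v0.
have hmin : empirical_risk_minimizer nll S h.
  move=> h'; have [s s0 hs] := densityP h'.
  rewrite (empirical_nll _ _ _ _ n0 hv) (empirical_nll _ _ _ _ n0 hs).
  exact: (gaussian_nll_min _ _ v0 s0).1.
have /(_ h) := hA n S n0 (ex_intro _ _ hmin).
have [s s0 hs] := densityP (A n S); rewrite hs.
rewrite (empirical_nll _ _ _ _ n0 hv) (empirical_nll _ _ _ _ n0 hs).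
rewrite (ge_leif (gaussian_nll_min _ _ v0 s0)).
by move/eqP->.
Qed.

End normal_erm.

(** * Expectations over Bernoulli words with few letters [true] *)

Definition unit_word n (j : 'I_n) : n.-tuple bool := [tuple i == j | i < n].

Section bernoulli_words.
Context {R : realType}.
Variables (q : R) (q0 : 0 <= q) (q1 : q <= 1).
Notation weight w := (\prod_i bernoulli_pmf q (tnth w i)).

Let pmf01 b : 0 <= bernoulli_pmf q b <= 1.
Proof.
move: q0 q1; rewrite /bernoulli_pmf.
by case: b => ? ?; apply/andP; split; lra.
Qed.

Lemma weight_unit_word n (j : 'I_n.+1) :
  weight (unit_word n.+1 j) = q * (1 - q) ^+ n.
Proof.
rewrite (bigD1 j)//= tnth_mktuple eqxx; congr (_ * _).
rewrite (eq_bigr (fun=> 1 - q)) => [|i ij]; last first.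
  by rewrite tnth_mktuple (negbTE ij).
by rewrite prodr_const cardC1 card_ord.
Qed.

Lemma weight_le_sqr n (w : n.-tuple bool) i j :
  i != j -> tnth w i -> tnth w j -> weight w <= q ^+ 2.
Proof.
move=> ij wi wj; rewrite (bigD1 i)//= (bigD1 j) 1?eq_sym//= wi wj /= mulrA.
rewrite -expr2 ler_piMr ?exprn_ge0//.
by apply: Num.Theory.prodr_ile1 => k _; exact: pmf01.
Qed.

(* Of the words with at least two letters [true] only the total mass, of order
   [q ^+ 2], is controlled. *)
Lemma expectation_words_ge n (F : n.+1.-tuple bool -> R) C : 0 <= C ->
  (forall w, - C <= F w) -> 0 <= F [tuple false | _ < n.+1] ->
  q * (1 - q) ^+ n * (\sum_j F (unit_word _ j)) - 2 ^+ n.+1 * q ^+ 2 * C <=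
  \sum_w weight w * F w.
Proof.
move=> C0 FC F0.
have -> : 2 ^+ n.+1 * q ^+ 2 * C = \sum_(w : n.+1.-tuple bool) q ^+ 2 * C.
  by rewrite sumr_const card_tuple card_bool -[RHS]mulr_natl natrX mulrA.
(* The sum over positions becomes a sum over words whose inner sum has at most one term, so the
   inequality can be checked word by word. *)
have -> : q * (1 - q) ^+ n * (\sum_j F (unit_word _ j)) =
    \sum_w \sum_(j | unit_word _ j == w) weight w * F w.
  rewrite (exchange_big_dep xpredT)//= mulr_sumr; apply: eq_bigr => j _.
  by rewrite (big_pred1 (unit_word _ j)) ?weight_unit_word// => w;
    rewrite eq_sym.
rewrite lerBlDr -big_split/=; apply: ler_sum => w _.
have wt0 : 0 <= weight w.
  by apply: prodr_ge0 => i _; case/andP : (pmf01 (tnth w i)).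
have qC : 0 <= q ^+ 2 * C by rewrite mulr_ge0// exprn_ge0.
(* Three cases: no letter [true], at least two, exactly one. The inner sum is nonempty only in the
   last. *)
case: (pickP (tnth w)) => [i wi|w0]; last first.
  have wE : w = [tuple false | _ < n.+1].
    by apply: eq_from_tnth => i; rewrite tnth_mktuple w0.
  rewrite big_pred0 => [|j].
    by rewrite addr_ge0// mulr_ge0// wE.
  apply/negP => /eqP/(congr1 (fun v => tnth v j)).
  by rewrite tnth_mktuple eqxx w0.
case: (pickP (fun j => (i != j) && tnth w j)) => [j /andP[ij wj]|wi1].
  rewrite big_pred0 => [|k].
    rewrite -lerBlDr sub0r -mulrN (@le_trans _ _ (weight w * - C))//.
      by rewrite !mulrN lerN2 ler_wpM2r// (weight_le_sqr _ _ i j).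
    by rewrite ler_wpM2l.
  apply/negP => /eqP wk; move: ij wi wj; rewrite -wk !tnth_mktuple.
  by move=> /eqP ij /eqP ik /eqP jk; apply: ij; rewrite ik jk.
have wE : w = unit_word _ i.
  apply: eq_from_tnth => j; rewrite tnth_mktuple eq_sym.
  by have := wi1 j; case: eqP => [<-|].
rewrite (big_pred1 i) ?lerDl// => j /=; rewrite wE.
apply/eqP/eqP => [/(congr1 (fun v => tnth v j))|->//].
by rewrite !tnth_mktuple eqxx => /esym/eqP.
Qed.

End bernoulli_words.

(** * The risk as a function of the frequency *)

Section excess.
Context {R : realType}.
Implicit Types (u q x : R) (n : nat).

(* Twice the risk of the normal density of variance [y * (1 + u * x)] when the
   true second moment is [y * (1 + q * u)], without the terms in [ln (pi *+ 2)]
   and [ln y]. *)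
Definition twice_excess u q x := ln (1 + u * x) + (1 + q * u) / (1 + u * x).

(** Provides the constant [u + 2] that controls the rare words, uniformly in [q] as long as
    [q * u <= 1]. *)
Lemma twice_excess_bounds u q x : 0 <= u -> 0 <= q * u <= 1 -> 0 <= x <= 1 ->
  0 <= twice_excess u q x <= u + 2.
Proof.
move=> u0 /andP[qu0 qu1] /andP[x0 x1].
have ux0 : 0 <= u * x by exact: mulr_ge0.
have uxu : u * x <= u by rewrite ler_piMr.
have ln0 : 0 <= ln (1 + u * x) by rewrite ln_ge0// lerDl.
have lnu : ln (1 + u * x) <= u.
  by rewrite (le_trans _ uxu)// le_ln1Dx//; lra.
have d0 : 0 <= (1 + q * u) / (1 + u * x) by rewrite divr_ge0//; lra.
have d2 : (1 + q * u) / (1 + u * x) <= 2.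
  by rewrite ler_pdivrMr; [nra|lra].
rewrite /twice_excess; apply/andP; split; lra.
Qed.

(** This [u] makes [1 + u / n.+1] equal to [expR 4], so the logarithms contribute at least
    [4 * n.+1 - (4 * n + 1) = 3]; the value at [0] is [1 + q * u <= 2], and the quotient terms
    contribute a nonnegative amount. *)
Lemma twice_excess_single n u q : (0 < n)%N -> 0 <= q * u <= 1 ->
  u = n.+1%:R * (expR 4 - 1) ->
  1 <= n.+1%:R * twice_excess u q n.+1%:R^-1 - n%:R * twice_excess u q n%:R^-1
       - twice_excess u q 0.
Proof.
move=> n0 /andP[qu0 qu1] uE.
have N0 : 0 < n%:R :> R by rewrite ltr0n.
have N1 : n.+1%:R = n%:R + 1 :> R by rewrite -natr1.
have u0 : 0 <= u.
  rewrite uE mulr_ge0//; have := expR_ge1Dx (4 : R); lra.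
rewrite /twice_excess mulr0 addr0 ln1 add0r divr1.
have uS : 1 + u * n.+1%:R^-1 = expR 4.
  by rewrite uE mulrAC divff ?mul1r 1?addrC ?subrK// pnatr_eq0.
(* [(1 + u / n) / (1 + u / n.+1) <= 1 + 1 / n], so replacing [n.+1] by [n] in
   the logarithm costs at most [n * ln (1 + 1 / n) <= 1]. *)
have lnn : n%:R * ln (1 + u * n%:R^-1) <= n%:R * 4 + 1.
  have -> : 1 + u * n%:R^-1 = expR 4 * ((1 + u / n%:R) / expR 4).
    by rewrite mulrCA divff ?mulr1// expR_eq0.
  have r0 : 0 < (1 + u / n%:R) / expR 4.
    rewrite divr_gt0 ?expR_gt0//.
    by have : 0 <= u / n%:R by [exact: divr_ge0 _ (ltW N0)]; lra.
  rewrite lnM ?posrE ?expR_gt0// expRK mulrDr lerD2l.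
  have : (1 + u / n%:R) / expR 4 <= 1 + n%:R^-1.
    rewrite ler_pdivrMr ?expR_gt0// -uS N1.
    rewrite -subr_ge0.
    have -> : (1 + n%:R^-1) * (1 + u / (n%:R + 1)) - (1 + u / n%:R) = n%:R^-1.
      by field; apply/andP; split; apply: lt0r_neq0; lra.
    by rewrite invr_ge0 ltW.
  have n1 : 0 < n%:R^-1 :> R by rewrite invr_gt0.
  rewrite -ler_ln ?posrE ?addr_gt0// => h.
  have := le_trans h (le_ln1Dx (lt_trans (ltrN10 _) n1)).
  by rewrite -(ler_pM2l N0) divff ?gt_eqF.
(* This is the growth in [k] of [k / (1 + u / k) = k ^+ 2 / (k + u)]. *)
have kap : 0 <= n.+1%:R / (1 + u * n.+1%:R^-1) - n%:R / (1 + u * n%:R^-1) :> R.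
  rewrite N1.
  have -> : (n%:R + 1) / (1 + u * (n%:R + 1)^-1) - n%:R / (1 + u * n%:R^-1) =
     (n%:R * (n%:R + 1) + (2 * n%:R + 1) * u) / ((n%:R + 1 + u) * (n%:R + u)).
    by field; rewrite !lt0r_neq0//; lra.
  by rewrite divr_ge0//; [nra|apply: mulr_ge0; lra].
have : 0 <= (1 + q * u) *
    (n.+1%:R / (1 + u * n.+1%:R^-1) - n%:R / (1 + u * n%:R^-1)).
  by rewrite mulr_ge0//; lra.
move: kap; rewrite uS expRK N1.
set a := (1 + q * u) / expR 4; set b := (1 + q * u) / _.
rewrite [in X in _ -> X -> _]mulrBr.
have -> : (1 + q * u) * ((n%:R + 1) / expR 4) = (n%:R + 1) * a.
  by rewrite /a mulrCA.
have -> : (1 + q * u) * (n%:R / (1 + u / n%:R)) = n%:R * b by rewrite /b mulrCA.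
rewrite !mulrDr; lra.
Qed.

End excess.

(** * Growth of the expected excess for a rare second point *)

Section words_excess.
Context {R : realType}.
Implicit Types (u q : R) (n : nat).

Definition frequency n (w : n.-tuple bool) : R :=
  n%:R^-1 * \sum_(i < n) (tnth w i)%:R.

Lemma frequency01 n (w : n.-tuple bool) : (0 < n)%N -> 0 <= frequency n w <= 1.
Proof.
move=> n0; have N0 : 0 < n%:R :> R by rewrite ltr0n.
rewrite /frequency; apply/andP; split; first by rewrite mulr_ge0 ?sumr_ge0.
rewrite ler_pdivrMl// mulr1 -[in leRHS](card_ord n) -sumr_const.
by apply: ler_sum => i _; rewrite lern1 leq_b1.
Qed.

Lemma frequency_false n : frequency n [tuple false | _ < n] = 0.
Proof. by rewrite /frequency big1 ?mulr0// => i _; rewrite tnth_mktuple. Qed.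

Lemma frequency_unit_word n (j : 'I_n) : frequency n (unit_word n j) = n%:R^-1.
Proof.
rewrite /frequency (bigD1 j)//= tnth_mktuple eqxx big1 ?addr0 ?mulr1// => i ij.
by rewrite tnth_mktuple (negbTE ij).
Qed.

Lemma sample_prefix_false n :
  sample_prefix [tuple false | _ < n.+1] = [tuple false | _ < n].
Proof. by apply: eq_from_tnth => i; rewrite !tnth_mktuple. Qed.

Lemma sample_prefix_unit_word n (j : 'I_n) :
  sample_prefix (unit_word n.+1 (widen_ord (leqnSn n) j)) = unit_word n j.
Proof. by apply: eq_from_tnth => i; rewrite !tnth_mktuple. Qed.

Lemma sample_prefix_unit_word_max n :
  sample_prefix (unit_word n.+1 ord_max) = [tuple false | _ < n].
Proof.
apply: eq_from_tnth => i; rewrite !tnth_mktuple.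
by rewrite -val_eqE/= ltn_eqF.
Qed.

Lemma expected_excess_increases n : (0 < n)%N ->
  exists u q, [/\ 0 < u, 0 <= q <= 1 &
    0 < \sum_(w : n.+1.-tuple bool) (\prod_i bernoulli_pmf q (tnth w i)) *
      (twice_excess u q (frequency _ w) -
       twice_excess u q (frequency _ (sample_prefix w)))].
Proof.
move=> n0; pose u : R := n.+1%:R * (expR 4 - 1).
(* With [q = M^-1], both [q * u <= 1] and [q <= 1] hold. The final [+ 1] leaves
   [1 - n * q - 2 ^+ n.+1 * q * (u + 2) = q], still positive, once [(1 - q) ^+ n] is bounded below
   by [1 - n * q]. *)
pose M : R := n%:R + 2 ^+ n.+1 * (u + 2) + 1.
have upos : 0 < u.
  rewrite mulr_gt0 ?ltr0n//; have := expR_ge1Dx (4 : R); lra.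
have u0 := ltW upos; have N0 : 0 < n%:R :> R by rewrite ltr0n.
have P1 : 1 <= 2 ^+ n.+1 :> R by rewrite exprn_ege1// ler1n.
have M0 : 0 < M by rewrite /M; nra.
have q0 : 0 < M^-1 by rewrite invr_gt0.
have qM : M^-1 * M = 1 by rewrite mulVf ?gt_eqF.
exists u, M^-1; set q := M^-1 in q0 qM *.
have uM : u <= M by rewrite /M; nra.
have q1 : q <= 1 by rewrite invf_le1//; rewrite /M; nra.
have qu : 0 <= q * u <= 1.
  apply/andP; split; first exact: mulr_ge0 (ltW q0) u0.
  by rewrite -[leRHS]qM ler_pM2l.
split=> //; first by rewrite ltW.
pose F (w : n.+1.-tuple bool) := twice_excess u q (frequency _ w) -
       twice_excess u q (frequency _ (sample_prefix w)).
have FC w : - (u + 2) <= F w.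
  have /andP[? _] :=
    twice_excess_bounds _ _ _ u0 qu (frequency01 _ w (ltn0Sn n)).
  have /andP[_ ?] :=
    twice_excess_bounds _ _ _ u0 qu (frequency01 _ (sample_prefix w) n0).
  by rewrite /F; lra.
have F0 : 0 <= F [tuple false | _ < n.+1].
  by rewrite /F sample_prefix_false !frequency_false subrr.
(* Dropping the last letter turns [n] of the unit words into unit words of length [n], and the one
   ending in [true] into the all-[false] word; this gives the combination in
   [twice_excess_single]. *)
have FE : 1 <= \sum_j F (unit_word _ j).
  have := twice_excess_single n u q n0 qu erefl.
  rewrite big_ord_recr/= /F sample_prefix_unit_word_max frequency_false.
  rewrite frequency_unit_word.
  rewrite (eq_bigr
    (fun=> twice_excess u q n.+1%:R^-1 - twice_excess u q n%:R^-1)).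
    by rewrite sumr_const card_ord -mulr_natl -natr1; lra.
  by move=> j _; rewrite sample_prefix_unit_word !frequency_unit_word.
have C0 : 0 <= u + 2 by lra.
apply: lt_le_trans (expectation_words_ge q (ltW q0) q1 _ F _ C0 FC F0).
have bern : 1 - n%:R * q <= (1 - q) ^+ n.
  elim: (n) => [|k IHk]; first by rewrite mul0r subr0 expr0.
  rewrite exprS -natr1.
  have : (1 - q) * (1 - k%:R * q) <= (1 - q) * (1 - q) ^+ k.
    by rewrite ler_wpM2l// subr_ge0.
  have : 0 <= k%:R :> R by [].
  nra.
have : 0 < q * ((1 - n%:R * q) - 2 ^+ n.+1 * q * (u + 2)).
  rewrite mulr_gt0//.
  have -> : 1 - n%:R * q - 2 ^+ n.+1 * q * (u + 2) = 1 - q * M + q.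
    by rewrite /M; ring.
  by rewrite qM; lra.
have p0 : 0 <= (1 - q) ^+ n by rewrite exprn_ge0// subr_ge0.
have : q * (1 - q) ^+ n <= q * (1 - q) ^+ n * (\sum_j F (unit_word _ j)).
  by rewrite ler_peMr// mulr_ge0// ltW.
have : q * (1 - n%:R * q) <= q * (1 - q) ^+ n by rewrite ler_pM2l.
rewrite expr2; set a := _ ^+ n; set s := \sum_j _; set t := _ ^+ n.+1.
nra.
Qed.

End words_excess.

(** * Two-point distributions near the origin *)

Lemma measurable_subset_space1 {R : realType} {Z : set R} {z0 : R}
  (Zz0 : Z z0) (z : subset_space Zz0) : measurable [set z].
Proof.
exists [set subset_incl Zz0 z]; first exact: measurable_set1.
by rewrite setTI; apply/seteqP; split => [y /= /val_inj|y ->].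
Qed.

(** The given ball is centred at [c], possibly away from the origin; the distance [r - |c|] from the
    origin to its boundary is a suitable radius. *)
Lemma ball_nbhs_origin {R : realType} (c r : R) : ball c r 0 ->
  exists2 e : R, 0 < e & forall y, `|y| < e -> ball c r y.
Proof.
rewrite /ball/= subr0 => cr; exists (r - `|c|); first by rewrite subr_gt0.
by move=> y ye; rewrite (le_lt_trans (ler_normB _ _))// -ltrBrDl.
Qed.

Section two_point.
Context {R : realType} {Z : set R} {z0 : R} (Zz0 : Z z0).
Notation space := (subset_space Zz0).
Notation nll := (neg_log_likelihood Zz0).
Variables (x : bool -> space) (y u q : R).
Hypothesis xE : forall b, subset_incl Zz0 (x b) ^+ 2 = y * (1 + u * b%:R).

Lemma mean_square_two_point n (w : n.-tuple bool) : (0 < n)%N ->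
  mean_square Zz0 n [tuple of map x w] = y * (1 + u * frequency n w).
Proof.
move=> n0; have N0 : n%:R != 0 :> R by rewrite pnatr_eq0 -lt0n.
rewrite /mean_square /frequency.
under eq_bigr => i _ do rewrite tnth_map xE mulrDr mulr1 mulrA.
rewrite big_split/= sumr_const card_ord -mulr_sumr -[y *+ n]mulr_natl.
by set K := \sum_(i < n) _; rewrite mulrDr mulKf// mulrDr mulr1 mulrCA -mulrA.
Qed.

(** The scale [y] cancels in the ratio of second moment to variance and survives only as [ln y],
    which is independent of [v] and so drops out of risk differences. *)
Lemma risk_two_point v : 0 < y -> 0 < 1 + u * v ->
  \sum_b bernoulli_pmf q b *
    gaussian_nll (y * (1 + u * v)) (subset_incl Zz0 (x b) ^+ 2) =
  (ln (pi *+ 2) + ln y + twice_excess u q v) / 2.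
Proof.
move=> y0 uv0; rewrite big_bool/= !xE /gaussian_nll /twice_excess.
rewrite /bernoulli_pmf mulr0 addr0 !mulr1 lnM ?posrE//.
set L := ln _; set M := ln y; set K := ln (1 + _); move: L M K => L M K.
by field; rewrite !gt_eqF.
Qed.

End two_point.

Theorem theorem3 (R : realType) (Z : set R)
    (hZ : exists c r : R, ball c r 0 /\ ball c r `<=` Z)
    (A : learner (subset_space (ball_sub_origin hZ))
                 (centered_normal_densities R))
    (hA : erm (neg_log_likelihood (ball_sub_origin hZ)) A)
    (N : nat) (hN : (0 < N)%N) :
  ~ weakly_monotonic (neg_log_likelihood (ball_sub_origin hZ)) N A.
Proof.
move=> /(_ N (leqnn N)) mono.
have [c [r [/ball_nbhs_origin[e e0 eball] ballZ]]] := hZ.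
have [u [q [upos q01 excess0]]] := @expected_excess_increases R N hN.
have u0 := ltW upos.
have s1 : 1 <= Num.sqrt (1 + u) by rewrite -[leLHS]sqrtr1 ler_wsqrtr// lerDl.
(* The larger point is fixed at [e / 2], inside the ball, and [a] is scaled down from it so that the
   squares have ratio [1 + u]. *)
pose a := e / 2 / Num.sqrt (1 + u).
have s0 := lt_le_trans ltr01 s1.
have a0 : 0 < a by rewrite !divr_gt0.
pose t b := if b then e / 2 else a.
have Zt b : Z (t b).
  apply/ballZ/eball; have e2 : e / 2 < e by rewrite ltr_pdivrMr//; lra.
  case: b => /=; rewrite gtr0_norm ?divr_gt0// (le_lt_trans _ e2)//.
  by rewrite ler_pdivrMr// ler_peMr// ltW// divr_gt0.
pose x b : subset_space (ball_sub_origin hZ) :=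
  exist (fun z => z \in Z) (t b) (mem_set (Zt b)).
have xt b : subset_incl (ball_sub_origin hZ) (x b) = t b by [].
have xE b : subset_incl (ball_sub_origin hZ) (x b) ^+ 2 =
    a ^+ 2 * (1 + u * b%:R).
  rewrite xt; case: b => /=; last by rewrite mulr0 addr0 mulr1.
  have u1 : 0 < 1 + u by lra.
  by rewrite mulr1 /a [in RHS]expr_div_n sqr_sqrtr ?divfK ?gt_eqF ?ltW.
(* The squares already differ, since [a] and [u] are nonzero. *)
have x_inj : injective x.
  move=> b b' /(congr1 (fun z => subset_incl (ball_sub_origin hZ) z ^+ 2)).
  rewrite !xE => /(mulfI (lt0r_neq0 (exprn_gt0 2 a0))).
  by move=> /addrI/(mulfI (lt0r_neq0 upos))/eqP; rewrite eqr_nat;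
    case: b b' => -[].
have mx b : measurable [set x b] by exact: measurable_subset_space1.
have [D DE] := exists_two_point_distribution q x q01.
have pmf0 b : 0 <= bernoulli_pmf q b by exact: bernoulli_pmf_ge0.
pose nll := neg_log_likelihood (ball_sub_origin hZ).
pose rsk h := \sum_b bernoulli_pmf q b * nll (x b) h.
have rskE h : risk nll D h = (rsk h)%:E.
  exact: (integral_finitely_supported _ _ _ DE).
have := mono D; rewrite /monotonic.
under eq_integral => S _ do rewrite !rskE -EFinB.
have map_x_inj n : injective (fun w : n.-tuple bool => [tuple of map x w]).
  by move=> v w /(congr1 val)/(inj_map x_inj)/val_inj.
have measurable_map_x n (w : n.-tuple bool) :
    measurable [set [tuple of map x w]].
  by apply: measurable_tuple1 => i; rewrite tnth_map.
have wt0 n (w : n.-tuple bool) : 0 <= \prod_(i < n) bernoulli_pmf q (tnth w i).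
  exact: prodr_ge0.
rewrite (integral_finitely_supported _ _ _
  (iid_finitely_supported _ _ _ DE pmf0 x_inj mx N.+1)
  (wt0 _) (map_x_inj _) (measurable_map_x _)).
rewrite lee_fin leNgt => /negP; apply.
(* As [a] is nonzero, every sample from the support has positive mean square, so [erm_nll]
   applies. *)
have rskA n (w : n.-tuple bool) : (0 < n)%N -> rsk (A n [tuple of map x w]) =
    (ln (pi *+ 2) + ln (a ^+ 2) + twice_excess u q (frequency n w)) / 2.
  move=> n0; have a20 : 0 < a ^+ 2 by exact: exprn_gt0.
  have v0 : 0 < 1 + u * frequency n w.
    by rewrite ltr_wpDr// mulr_ge0//; case/andP : (@frequency01 R n w n0).
  rewrite -(risk_two_point _ x _ _ _ xE)// /rsk.
  apply: eq_bigr => b _; rewrite /nll (erm_nll _ _ hA)//.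
    by rewrite (mean_square_two_point _ x _ _ xE).
  by rewrite (mean_square_two_point _ x _ _ xE)// mulr_gt0.
(* Prefixes commute with [map x], and the additive constants of the two risks cancel, leaving half
   the difference of [twice_excess]. *)
under eq_bigr => w _.
  have -> : sample_prefix [tuple of map x w] =
      [tuple of map x (sample_prefix w)].
    by apply: eq_from_tnth => i; rewrite !(tnth_mktuple, tnth_map).
  rewrite !rskA// -mulrBl opprD addrACA subrr add0r mulrA.
  over.
by rewrite -mulr_suml divr_gt0.
Qed.
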